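(* Let $G=(V,E)$ be a graph on $n$ vertices with $m$ edges which is a disjoint union of $p$ complete graphs $G_1,\dots,G_p$ (its components), so that $\sum_{i=1}^p |V(G_i)|=n$ and $m=\sum_{i=1}^p\binom{|V(G_i)|}{2}$. Then $G$ is a Largest Eigenvalue Local Minimizer (LELM). In other words, $\lambda_1(G)$ is locally minimized, i.e. minimized with respect to one edge reconnects, one edge removals and one edge additions: $\lambda_1(G)\leqslant\lambda_1(G')$ for every simple graph $G'$ obtained from $G$ by a one edge reconnect, a one edge removal or a one edge addition. Further, $\lambda_1(G)=\max_{i\in\{1,\dots,p\}}|V(G_i)|$.
   Context: All graphs are simple, undirected and unweighted (no self loops, no multiple edges). The Laplacian of $G$ is $L(G)=D(G)-A(G)$, where $D(G)$ is the diagonal matrix of vertex degrees and $A(G)$ is the adjacency matrix; $\lambda_1(G)$ denotes the largest eigenvalue of $L(G)$. One edge reconnect: given a simple graph $G_0=(V,E_0)$ with $|V|=n$, $|E_0|=m$, a simple graph $G_1=(V,E_1)$ is a one-edge reconnect of $G_0$ if one or both of the end nodes of exactly one edge differ from those of $G_0$; that is, $G_1$ is obtained from $G_0$ by removing one edge and adding one different edge between two vertices not adjacent in $G_0$ (so $|E_1|=m$ and $\operatorname{rank}(L(G_1)-L(G_0))=2$). One edge addition: adding one edge to the graph while keeping it simple. One edge removal: deleting one edge of the graph. In all cases the vertex set is unchanged. A graph $G_0$ is a Largest Eigenvalue Local Minimizer (LELM) if $\lambda_1(G_0)$ is least among all simple graphs obtained from $G_0$ by either a one edge reconnect or a one edge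 addition, i.e. $\lambda_1(G_0)\leqslant\lambda_1(G')$ for each such graph $G'$.
   Formalization: Minimality under one edge removals is stated only for m ≠ 1 (if m = 1, removing the edge drops λ₁ from 2 to 0), and λ₁(G) = max|V(G_i)| only for m > 0 (if m = 0, λ₁ = 0 while the maximum is 1). *)

(* Defs.v *)
From HB Require Import structures.
From mathcomp Require Import boolp classical_sets reals.
(* Loaded last, so that set0, bigcup etc. refer to finite sets. *)
From mathcomp Require Import all_boot all_order all_algebra.

Set Implicit Arguments.
Unset Strict Implicit.
Unset Printing Implicit Defensive.

Import Order.TTheory GRing.Theory Num.Theory.
Local Open Scope ring_scope.

(* An edge is a set of exactly two vertices, so that there are neither loops
   nor multiple edges. *)
Record sgraph (n : nat) := SGraph {
  edges : {set {set 'I_n}};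
  edges_card2 : forall e, e \in edges -> #|e| = 2%N
}.

Definition adj n (G : sgraph n) : rel 'I_n :=
  fun i j => [set i; j] \in edges G.

Definition degree n (G : sgraph n) (i : 'I_n) : nat := #|[set j | adj G i j]|.

Definition degree_mx (R : pzRingType) n (G : sgraph n) : 'M[R]_n :=
  diag_mx (\row_i (degree G i)%:R).

Definition adjacency_mx (R : pzRingType) n (G : sgraph n) : 'M[R]_n :=
  \matrix_(i, j) (adj G i j)%:R.

Definition laplacian (R : pzRingType) n (G : sgraph n) : 'M[R]_n :=
  degree_mx R G - adjacency_mx R G.

(* For 0 < n the supremum is attained: see [lambda1_largest] below. *)
Definition lambda1 (R : realType) n (G : sgraph n) : R :=
  sup [set a : R | eigenvalue (laplacian R G) a]%classic.

(* In the next three definitions G' is simple by its type; in particular the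
   added set f is a pair of distinct vertices, not adjacent in G. *)
Definition edge_addition n (G G' : sgraph n) : Prop :=
  exists f : {set 'I_n}, f \notin edges G /\ edges G' = f |: edges G.

Definition edge_removal n (G G' : sgraph n) : Prop :=
  exists e : {set 'I_n}, e \in edges G /\ edges G' = edges G :\ e.

Definition edge_reconnect n (G G' : sgraph n) : Prop :=
  exists e f : {set 'I_n},
    [/\ e \in edges G, f \notin edges G & edges G' = f |: (edges G :\ e)].

Definition LELM (R : realType) n (G : sgraph n) : Prop :=
  forall G' : sgraph n,
    edge_reconnect G G' \/ edge_addition G G' -> lambda1 R G <= lambda1 R G'.

(* [C i] is the vertex set of the i-th complete graph. The identities
   n = sum |C i| and m = sum 'C(|C i|, 2) follow: see [sum_card_parts] and
   [card_edges_parts]. *)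
Definition disjoint_union_of_complete n p (G : sgraph n)
    (C : 'I_p -> {set 'I_n}) : Prop :=
  [/\ forall i, C i != set0,
      forall i j, i != j -> [disjoint C i & C j],
      \bigcup_(i < p) C i = [set: 'I_n] &
      forall u v, u != v ->
        adj G u v = [exists i, (u \in C i) && (v \in C i)]].

Lemma sum_card_parts n p (G : sgraph n) (C : 'I_p -> {set 'I_n}) :
  disjoint_union_of_complete G C -> (\sum_(i < p) #|C i| = n)%N.
Proof.
case=> _ Cdis Ccov _; rewrite -[RHS]card_ord -cardsT -Ccov.
rewrite -sum1_card partition_disjoint_bigcup //=.
by apply: eq_bigr => i _; rewrite sum1_card.
Qed.

Lemma card_edges_parts n p (G : sgraph n) (C : 'I_p -> {set 'I_n}) :
  disjoint_union_of_complete G C ->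
  (#|edges G| = \sum_(i < p) 'C(#|C i|, 2))%N.
Proof.
case=> _ Cdis _ Cadj.
pose D (i : 'I_p) := [set e : {set 'I_n} | e \subset C i & #|e| == 2%N].
have -> : edges G = \bigcup_(i < p) D i.
  apply/setP => e; have [e2|e2] := eqVneq #|e| 2%N; last first.
    transitivity false; first by apply/negbTE; apply: contraNN e2 => /edges_card2 ->.
    by apply/esym/negbTE/bigcupP => -[i _]; rewrite inE (negPf e2) andbF.
  have /cards2P[u [v [uv ->]]] : #|e| == 2%N by apply/eqP.
  rewrite -/(adj G u v) (Cadj _ _ uv).
  apply/existsP/bigcupP => [[i Hi]|[i _]].
    by exists i => //; rewrite inE subUset !sub1set cards2 uv Hi.
  by rewrite inE subUset !sub1set => /andP[Hi _]; exists i.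
rewrite -sum1_card partition_disjoint_bigcup /= => [|i j ij].
  by apply: eq_bigr => i _; rewrite sum1_card /D cards_draws.
apply/pred0P => e /=; apply/negP; rewrite !inE.
case/andP=> /andP[ei e2] /andP[ej _].
have /cards2P[u [v [_ E]]] := e2.
have ue : u \in e by rewrite E set21.
by have := disjointFr (Cdis _ _ ij) (subsetP ei u ue); rewrite (subsetP ej u ue).
Qed.

Lemma laplacian_ones (R : pzRingType) n (G : sgraph n) :
  laplacian R G *m const_mx 1 = 0 :> 'cV[R]_n.
Proof.
apply/matrixP => i j; rewrite mulmxBl mul_diag_mx !mxE mulr1.
under eq_bigr do rewrite !mxE mulr1.
rewrite /degree -sum1_card natr_sum big_mkcond /=.
rewrite -sumrB big1 // => k _.
by rewrite inE; case: (adj G i k); rewrite subrr.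
Qed.

Lemma laplacian_sym (R : pzRingType) n (G : sgraph n) :
  (laplacian R G)^T = laplacian R G.
Proof.
rewrite /laplacian linearB /= tr_diag_mx; congr (_ - _).
by apply/matrixP => i j; rewrite !mxE /adj setUC.
Qed.

Lemma poly_finite_roots (F : fieldType) (p : {poly F}) : p != 0 ->
  exists s : seq F, forall x, root p x -> x \in s.
Proof.
have [k] := ubnP (size p); elim: k p => // k IHk p pk p0.
have [[x px]|npx] := pselect (exists x, root p x); last first.
  by exists [::] => x px; case: npx; exists x.
have /factor_theorem[q pq] := px.
have q0 : q != 0 by apply: contraNneq p0 => q0; rewrite pq q0 mul0r.
have [|s sP] := IHk q _ q0.
  by move: pk; rewrite pq size_Mmonic ?monicXsubC // size_XsubC addn2.
exists (x :: s) => y; rewrite pq rootM root_XsubC inE => /orP[/sP->|->] //.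
by rewrite orbT.
Qed.

Lemma lambda1_largest (R : realType) n (G : sgraph n) : (0 < n)%N ->
  eigenvalue (laplacian R G) (lambda1 R G) /\
  forall a, eigenvalue (laplacian R G) a -> a <= lambda1 R G.
Proof.
move=> n0; set L := laplacian R G.
have S0 : eigenvalue L 0.
  apply/eigenvalueP; exists (const_mx 1).
    by rewrite scale0r -[LHS]trmxK trmx_mul laplacian_sym trmx_const
      laplacian_ones trmx0.
  by apply/eqP => /matrixP /(_ 0 (Ordinal n0)); rewrite !mxE; apply/eqP/oner_neq0.
have [s sP] : exists s : seq R, forall x, eigenvalue L x -> x \in s.
  have [|s sP] := @poly_finite_roots _ (char_poly L).
    by rewrite monic_neq0 // char_poly_monic.
  by exists s => x; rewrite eigenvalue_root_char; apply: sP.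
have [M [LM Mmax]] : exists M, eigenvalue L M /\
    forall x, x \in s -> eigenvalue L x -> x <= M.
  elim: (s) => [|x t [M [LM Mmax]]]; first by exists 0.
  have [Lx|Lx] := boolP (eigenvalue L x); last first.
    exists M; split=> // y; rewrite inE => /orP[/eqP-> Ly|/Mmax//].
    by rewrite Ly in Lx.
  exists (Num.max M x); split; first by case: (leP M x).
  move=> y; rewrite inE => /orP[/eqP-> _|yt Ly]; rewrite le_max ?lexx ?orbT //.
  by rewrite Mmax.
suff -> : lambda1 R G = M by split=> // a La; apply: Mmax (sP _ La) La.
have ubM : ubound [set a : R | eigenvalue L a]%classic M.
  by move=> x /= Lx; apply: Mmax (sP _ Lx) Lx.
apply/eqP; rewrite eq_le; apply/andP; split.
  by apply: ge_sup => //; exists 0.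
by apply: ub_le_sup => //; exists M.
Qed.

(* Main.v *)
(* Let N be the largest clique size. On the union of cliques an eigenvector for
   a nonzero eigenvalue sums to zero on each clique, so every eigenvalue is at
   most N. Conversely, suppose that all pairs in A x B are edges; then the
   vector equal to |B| on A, -|A| on B and 0 elsewhere has Rayleigh quotient at
   least |A| + |B|, whatever the other edges are. Deleting one edge e from a
   clique K with at least 3 vertices leaves such a join with |A| + |B| = |K|:
   take A = e if e lies in K, and a single vertex otherwise. For N <= 2 it
   suffices that the modified graph still has an edge. *)

Require Import Defs.
From HB Require Import structures.
From mathcomp Require Import boolp classical_sets reals.
From mathcomp Require Import all_boot all_order all_algebra.
From mathcomp Require Import spectral complex ring.

Set Implicit Arguments.
Unset Strict Implicit.
Unset Printing Implicit Defensive.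

Import Order.TTheory GRing.Theory Num.Theory.
Local Open Scope ring_scope.

(** Over [complex F] the matrix is Hermitian, hence unitarily diagonalizable with real eigenvalues.
    In eigencoordinates the difference of the two forms is a sum of squares weighted by [r j - c],
    which cannot be nonnegative at a nonzero vector if all weights are negative. *)
Lemma eigenvalue_ge_rayleigh (F : rcfType) n (A : 'M[F]_n) (x : 'rV[F]_n)
    (c : F) :
  A^T = A -> x != 0 -> c * (x *m x^T) 0 0 <= (x *m A *m x^T) 0 0 ->
  exists2 a, eigenvalue A a & c <= a.
Proof.
move=> symA x0 xAx.
pose toC := real_complex F : {rmorphism F -> complex F}.
pose A' := map_mx toC A; pose x' := map_mx toC x.
have conj_toC k l (B : 'M[F]_(k, l)) : map_mx Num.conj (map_mx toC B) = map_mx toC B.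
  by apply/matrixP => i j; rewrite !mxE; apply: conjc_real.
have hA : A' \is hermsymmx.
  by apply/is_hermitianmxP; rewrite expr0 scale1r /A' map_trmx symA conj_toC.
set P := spectralmx A'; set d := spectral_diag A'.
have /hermitian_normalmx/orthomx_spectralP := hA.
rewrite -/P -/d => defA.
have Pu : P \in unitmx := spectral_unit A'.
have Punitary : P \is unitarymx := spectral_unitarymx A'.
pose r j := complex.Re (d 0 j).
have rE j : d 0 j = toC (r j).
  by apply/esym/RRe_real; have /mxOverP := hermitian_spectral_diag_real hA; apply.
(* Being an eigenvalue is a root condition on the characteristic polynomial, so it descends from
   [complex F] to [F] along [toC]. *)
have eig_r j : eigenvalue A (r j).
  rewrite eigenvalue_root_char -(fmorph_root toC) -rE map_char_poly.
  rewrite -eigenvalue_root_char; apply/eigenvalueP; exists (row j P).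
    rewrite -/A' -row_mul [in LHS]defA mulmxA mulmxA mulmxV // mul1mx.
    by apply/rowP => k; rewrite mul_diag_mx !mxE.
  rewrite rowE mulmx_free_eq0 ?row_free_unit //.
  by apply/eqP => /matrixP/(_ 0 j)/eqP; rewrite !mxE !eqxx oner_eq0.
pose y := x' *m invmx P.
have x'E : x' = y *m P by rewrite mulmxKV.
have y_conj : map_mx Num.conj y^T = P *m x'^T.
  have x'_conj : map_mx Num.conj x'^T = x'^T by rewrite /x' map_trmx conj_toC.
  rewrite /y invmx_unitary // trmx_mul map_mxM x'_conj map_trmx trmxK.
  by rewrite -map_mx_comp (map_mx_id (@conjCK _)).
have formE : toC ((x *m A *m x^T) 0 0 - c * (x *m x^T) 0 0) =
    \sum_j toC (r j - c) * `|y 0 j| ^+ 2.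
  transitivity ((x' *m A' *m x'^T) 0 0 - toC c * (x' *m x'^T) 0 0).
    have entry (B : 'M_1) : toC (B 0 0) = map_mx toC B 0 0 by rewrite mxE.
    by rewrite rmorphB rmorphM !entry !map_mxM -map_trmx.
  have -> : x' *m x'^T = y *m map_mx Num.conj y^T by rewrite y_conj mulmxA -x'E.
  rewrite defA !mulmxA -/y -[_ *m P *m _]mulmxA -y_conj.
  rewrite mul_mx_diag !mxE mulr_sumr -sumrB; apply: eq_bigr => j _.
  by rewrite !mxE normCK rE rmorphB; ring.
(* If every [r j < c], the terms of [formE] are nonpositive with a nonnegative sum, so each
   vanishes; this forces [y = 0] and then [x = 0]. *)
apply: contrapT => le_c.
have r_lt j : r j < c by rewrite ltNge; apply/negP => le; apply: le_c; exists (r j).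
have terms_le0 j : toC (r j - c) * `|y 0 j| ^+ 2 <= 0.
  by rewrite mulr_le0_ge0 ?exprn_ge0 // -(rmorph0 toC) lecR subr_le0 ltW.
case/eqP: x0; suff y0 : y = 0.
  by apply/(map_mx_inj (f := toC)); rewrite map_mx0 -/x' x'E y0 mul0mx.
apply/rowP => j; rewrite [RHS]mxE; apply/eqP.
have : 0 <= \sum_j toC (r j - c) * `|y 0 j| ^+ 2.
  by rewrite -formE -(rmorph0 toC) lecR subr_ge0.
rewrite -oppr_le0 -sumrN => sum_le0.
have terms_ge0 i : true -> 0 <= - (toC (r i - c) * `|y 0 i| ^+ 2) by rewrite oppr_ge0.
have sum0 : \sum_i - (toC (r i - c) * `|y 0 i| ^+ 2) = 0.
  by apply: le_anti; rewrite sum_le0 sumr_ge0.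
have /eqP := psumr_eq0P terms_ge0 sum0 (i := j) isT.
rewrite oppr_eq0 mulf_eq0 fmorph_eq0 subr_eq0 lt_eqF //=.
by rewrite expf_eq0 normr_eq0.
Qed.

(** The factor 2 appears because the double sum runs over ordered pairs and meets each edge
    twice. *)
Lemma laplacian_form (R : realType) n (G : sgraph n) (x : 'rV[R]_n) :
  2 * (x *m laplacian R G *m x^T) 0 0 =
  \sum_i \sum_j (adj G i j)%:R * (x 0 i - x 0 j) ^+ 2.
Proof.
have form1 : (x *m laplacian R G *m x^T) 0 0 =
    \sum_i \sum_j (adj G i j)%:R * (x 0 i * (x 0 i - x 0 j)).
  rewrite -mulmxA mxE; apply: eq_bigr => i _.
  rewrite mulmxBl mul_diag_mx !mxE /degree -sum1_card natr_sum big_mkcond /=.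
  rewrite mulr_suml -sumrB mulr_sumr; apply: eq_bigr => j _.
  by rewrite !mxE inE; case: (adj G i j) => /=; ring.
(* Of the two copies of [form1], the second has [i] and [j] exchanged; added termwise they complete
   the square. *)
rewrite mulr_natl mulr2n {1}form1 form1 [X in _ + X]exchange_big -big_split /=.
apply: eq_bigr => i _; rewrite -big_split; apply: eq_bigr => j _ /=.
by rewrite /adj [[set j; i]]setUC; ring.
Qed.

Lemma lambda1_ge_join (R : realType) n (G : sgraph n) (A B : {set 'I_n}) :
  A != set0 -> B != set0 -> [disjoint A & B] ->
  {in A & B, forall u v, adj G u v} -> (#|A| + #|B|)%:R <= lambda1 R G.
Proof.
move=> A0 B0 AB adjAB.
have n_gt0 : (0 < n)%N by case/set0Pn: A0 => u _; apply: leq_ltn_trans (ltn_ord u).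
pose a : R := #|A|%:R; pose b : R := #|B|%:R.
pose iA i : R := (i \in A)%:R; pose iB i : R := (i \in B)%:R.
have sumA : \sum_i iA i = a.
  by rewrite /iA /a -sum1_card natr_sum [RHS]big_mkcond; apply: eq_bigr => i _; case: ifP.
have sumB : \sum_i iB i = b.
  by rewrite /iB /b -sum1_card natr_sum [RHS]big_mkcond; apply: eq_bigr => i _; case: ifP.
have a_gt0 : 0 < a by rewrite ltr0n card_gt0.
have b_gt0 : 0 < b by rewrite ltr0n card_gt0.
pose x := \row_i (b * iA i - a * iB i).
have notAB i : i \in A -> i \in B -> False by move=> iAi; rewrite (disjointFr AB iAi).
have [||l Ll le_l] := @eigenvalue_ge_rayleigh _ _ (laplacian R G) x (a + b) (laplacian_sym R G).
- case/set0Pn: A0 => u uA; apply/eqP => /rowP/(_ u)/eqP.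
  by rewrite !mxE /iA /iB uA (disjointFr AB uA) mulr0 subr0 mulr1 gt_eqF.
- have -> : (x *m x^T) 0 0 = a * b * (a + b).
    transitivity (\sum_i (b ^+ 2 * iA i + a ^+ 2 * iB i)); last first.
      by rewrite big_split -!mulr_sumr sumA sumB /=; ring.
    rewrite mxE; apply: eq_bigr => i _; rewrite !mxE /iA /iB.
    have := notAB i; case: (i \in A); case: (i \in B) => H; first (by case: H); rewrite /=; ring.
  rewrite -(ler_pM2l (ltr0n _ 2)) laplacian_form.
  (* Keep only the ordered pairs between [A] and [B]: there the entries of [x] differ by [a + b] up
     to sign, and every discarded term is nonnegative. *)
  apply: (@le_trans _ _ (\sum_i \sum_j (iA i * iB j + iB i * iA j) * (a + b) ^+ 2)).
    under [leRHS]eq_bigr => i _ do rewrite -mulr_suml big_split -!mulr_sumr /=.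
    rewrite sumA sumB -mulr_suml big_split -!mulr_suml sumA sumB /=.
    by rewrite [leLHS](_ : _ = (a * b + b * a) * (a + b) ^+ 2) //; ring.
  apply: ler_sum => i _; apply: ler_sum => j _; rewrite !mxE.
  have adj_sym : adj G i j = adj G j i by rewrite /adj setUC.
  have := notAB i; have := notAB j; have := adjAB i j; have := adjAB j i.
  rewrite -adj_sym /iA /iB.
  case: (i \in A); case: (i \in B); case: (j \in A); case: (j \in B) => /= H1 H2 H3 H4;
    first [by case: H3 | by case: H4
      | by rewrite !(mulr0, mul0r, addr0) mulr_ge0 ?ler0n ?sqr_ge0
      | by rewrite (H1 isT isT) /= le_eqVlt; apply/orP; left; apply/eqP; ring
      | by rewrite (H2 isT isT) /= le_eqVlt; apply/orP; left; apply/eqP; ring].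
rewrite natrD; apply: le_trans le_l _.
by have [_] := lambda1_largest R G n_gt0; apply.
Qed.

Lemma lambda1_le_max (R : realType) n p (G : sgraph n)
    (C : 'I_p -> {set 'I_n}) :
  disjoint_union_of_complete G C -> (0 < n)%N ->
  lambda1 R G <= (\max_(i < p) #|C i|)%:R.
Proof.
move=> hG n_gt0; have [+ _] := lambda1_largest R G n_gt0.
set l := lambda1 R G => /eigenvalueP[v vL v0].
case: hG => _ Cdis Ccov Cadj.
have [-> //|l0] := eqVneq l 0.
have memC i k : i \in C k -> forall j, j != i -> adj G j i = (j \in C k).
  move=> iCk j ji; rewrite Cadj //; apply/existsP/idP => [[k' /andP[jk' ik']]|jk].
    have [<- //|kk'] := eqVneq k' k.
    by have := disjointFr (Cdis _ _ kk') ik'; rewrite iCk.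
  by exists k; rewrite jk.
have irr i : adj G i i = false.
  by apply/negP => /edges_card2; rewrite setUid cards1.
(* On a clique the Laplacian acts as [#|C k|] times the identity minus the all-ones matrix. *)
have row_eq i k : i \in C k ->
    #|C k|%:R * v 0 i - \sum_(j in C k) v 0 j = l * v 0 i.
  move=> iCk; move/rowP/(_ i): vL; rewrite mulmxBr mul_mx_diag !mxE => <-.
  have -> : \sum_(j in C k) v 0 j = v 0 i + \sum_j v 0 j * adjacency_mx R G j i.
    rewrite (bigD1 i) //=; congr (_ + _); rewrite big_mkcond; apply: eq_bigr => j _.
    rewrite !mxE; have [->|ji] := eqVneq j i; first by rewrite irr andbF mulr0.
    by rewrite (memC _ _ iCk) // andbT; case: ifP; rewrite (mulr1, mulr0).
  have -> : degree G i = #|C k :\ i|.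
    apply: eq_card => j; rewrite !inE; have [->|ji] := eqVneq j i; first by rewrite irr.
    by rewrite /= -(memC _ _ iCk) // /adj setUC.
  by rewrite (cardsD1 i (C k)) iCk natrD /=; ring.
have sum0 k : \sum_(j in C k) v 0 j = 0.
  (* Summing [row_eq] over the clique cancels its left side, and [l] is nonzero. *)
  have : \sum_(j in C k) (#|C k|%:R * v 0 j - \sum_(j in C k) v 0 j)
      = \sum_(j in C k) l * v 0 j by apply: eq_bigr => j; apply: row_eq.
  rewrite sumrB -!mulr_sumr sumr_const mulr_natl subrr => /esym/eqP.
  by rewrite mulf_eq0 (negPf l0) => /eqP.
have [i vi] : exists i, v 0 i != 0.
  by apply/existsP; apply: contraNT v0 => /existsPn vi; apply/eqP/rowP => i;
    rewrite mxE; have := vi i; rewrite negbK => /eqP.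
have : i \in [set: 'I_n] by rewrite inE.
rewrite -Ccov => /bigcupP[k _ ik].
(* At a vertex where [v] is nonzero, [row_eq] now says that [l] equals the size of its clique. *)
have := row_eq i k ik; rewrite sum0 subr0 => /(mulIf vi) <-.
by rewrite ler_nat; apply: (leq_bigmax k).
Qed.

(* Covers reconnects, removals and additions at once; take [e := set0] when no
   edge is lost. *)
Lemma max_le_lambda1 (R : realType) n p (G G' : sgraph n)
    (C : 'I_p -> {set 'I_n}) (e : {set 'I_n}) :
  disjoint_union_of_complete G C ->
  (0 < #|edges G'|)%N -> edges G :\ e \subset edges G' ->
  (\max_(i < p) #|C i|)%:R <= lambda1 R G'.
Proof.
move=> hG + sub; rewrite card_gt0 => /set0Pn[f fG'].
have /cards2P[u [v [uv defuv]]] : #|f| == 2%N by rewrite (edges_card2 fG').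
have [le2|gt2] := leqP (\max_(i < p) #|C i|) 2.
  apply: le_trans (_ : (#|[set u]| + #|[set v]|)%:R <= _).
    by rewrite !cards1 ler_nat.
  apply: lambda1_ge_join; rewrite ?set10 -?card_gt0 ?cards1 //.
    by rewrite disjoints1 inE.
  by move=> _ _ /set1P-> /set1P->; rewrite /adj -defuv.
case: hG => _ _ _ Cadj.
have [k maxk] : exists k, \max_(i < p) #|C i| = #|C k|.
  have [|k ->] := @bigop.eq_bigmax _ (fun i => #|C i|); last by exists k.
  rewrite card_ord lt0n; apply: contraTneq gt2 => p0.
  (* An empty maximum is 0, so [gt2] rules out [p = 0]. *)
  by rewrite big1 // => i; have := ltn_ord i; rewrite [X in (_ < X)%N]p0.
rewrite maxk in gt2 *.
suff [A [sAC A0 AC Ae]] : exists A : {set 'I_n}, [/\ A \subset C k, A != set0,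
    C k :\: A != set0 & {in A & C k :\: A, forall a b, [set a; b] != e}].
  rewrite -(cardsID A (C k)) (setIidPr sAC); apply: lambda1_ge_join => //.
    by rewrite -setI_eq0 setIDA setDIl setDv set0I.
  move=> a b aA bCA; apply: (subsetP sub); rewrite !inE Ae // -/(adj G a b).
  move: bCA; rewrite !inE => /andP[bA bC].
  rewrite Cadj; first by apply/existsP; exists k; rewrite bC (subsetP sAC).
  by apply: contraNneq bA => <-.
have [/andP[eC /eqP e2]|not_e] := boolP ((e \subset C k) && (#|e| == 2%N)).
  (* A pair with a vertex outside [e] differs from [e], and [gt2] leaves such a vertex in [C k]. *)
  exists e; split; rewrite // -?card_gt0 ?e2 //.
    by rewrite cardsDS // e2 subn_gt0.
  by move=> a b _; rewrite inE => /andP[be _]; apply: contraNneq be => <-; rewrite set22.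
have /card_gt0P[w wC] : (0 < #|C k|)%N by apply: ltn_trans gt2.
(* Any [w] works: a pair of distinct vertices of [C k] equal to [e] would contradict [not_e]. *)
exists [set w]; split; rewrite ?sub1set -?card_gt0 ?cards1 //.
  by rewrite cardsDS ?sub1set // cards1 subn_gt0 (ltn_trans _ gt2).
move=> a b /set1P-> ; rewrite !inE => /andP[bw bC]; apply: contraNneq not_e => <-.
by rewrite subUset !sub1set wC bC cards2 [w == b]eq_sym bw.
Qed.

(** Removing the only edge would lower [lambda1] from 2 to 0, whence [m <> 1]. An edgeless graph on
    at least one vertex has [lambda1] equal to 0 but cliques of size 1, whence [0 < m] in the last
    claim. *)
Theorem theorem3p6 (R : realType) (n m p : nat) (G : sgraph n)
    (C : 'I_p -> {set 'I_n}) (hm : #|edges G| = m)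
    (hG : disjoint_union_of_complete G C) :
  [/\ LELM R G,
      m <> 1%N ->
        forall G' : sgraph n, edge_removal G G' -> lambda1 R G <= lambda1 R G' &
      (0 < m)%N -> lambda1 R G = (\max_(i < p) #|C i|)%:R].
Proof.
have n_gt0 (G' : sgraph n) : (0 < #|edges G'|)%N -> (0 < n)%N.
  case/card_gt0P => f /edges_card2 f2; have /card_gt0P[u _] : (0 < #|f|)%N by rewrite f2.
  exact: leq_ltn_trans (ltn_ord u).
have main (G' : sgraph n) e : (0 < #|edges G'|)%N ->
    edges G :\ e \subset edges G' -> lambda1 R G <= lambda1 R G'.
  move=> G'0 sub; apply: le_trans (lambda1_le_max R hG (n_gt0 _ G'0)) _.
  exact: max_le_lambda1 hG G'0 sub.
split=> [G'|m1 G' [e [eG defG']]|m0].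
- case=> [[e [f [_ _ defG']]]|[f [_ defG']]];
    have G'0 : (0 < #|edges G'|)%N.
  + by apply/card_gt0P; exists f; rewrite defG' setU11.
  + by apply: (main _ e) => //; rewrite defG' subsetUr.
  + by apply/card_gt0P; exists f; rewrite defG' setU11.
  + by apply: (main _ set0) => //; rewrite defG' (subset_trans (subsetDl _ _)) ?subsetUr.
- apply: (main _ e); rewrite defG' //.
  by move: hm m1; rewrite (cardsD1 e) eG => <-; case: #|_|.
- apply/eqP; rewrite eq_le (lambda1_le_max R hG (n_gt0 G _)) ?hm //=.
  by apply: (max_le_lambda1 R (e := set0) hG); rewrite ?hm ?subsetDl.
Qed.
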